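(* Let $n$ be a positive integer and let $G$ be a finite $2$-regular graph with $2n-1\le |V(G)|\le 2n$. Then $f_G(n,n-1)=n-1$.
   Context: For a collection $\mathcal{F}=(F_1,\dots,F_k)$ of sets (not necessarily distinct), a rainbow set of $\mathcal{F}$ is a set $\{x_{i_1},\dots,x_{i_m}\}$ of $m$ distinct elements with $i_1<\dots<i_m$ distinct indices in $[k]$ and $x_{i_j}\in F_{i_j}$ for each $j$. Given a graph $G$ and a collection $\mathcal{F}$ of independent sets of $G$, a rainbow independent set of $(\mathcal{F},G)$ is a rainbow set of $\mathcal{F}$ that is also an independent set of $G$; an $m$-set is a set of size $m$. For integers $m\le n$, $f_G(n,m)$ denotes the minimal number $k$ such that every collection of $k$ (not necessarily distinct) independent $n$-sets of $G$ has a rainbow independent $m$-set.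
   Formalization: If G has no independent n-set (e.g. G=C_7, n=4) the literal minimum f_G(n,n-1) is vacuously 1, not n-1; in that case only, f_G(n,m) is taken to be the least such k with k at least m, and otherwise it is the literal minimum. *)

(* Defs.v *)
From mathcomp Require Import all_boot.

Set Implicit Arguments.
Unset Strict Implicit.
Unset Printing Implicit Defensive.

Section RainbowIndependentSets.

(* A finite simple graph is a symmetric irreflexive relation [e] on a finType;
   both properties are assumed where they are used, not here. *)
Variables (T : finType) (e : rel T).

Definition regular (d : nat) : Prop := forall x : T, #|[set y | e x y]| = d.

Definition independent (S : {set T}) : bool :=
  [forall x in S, forall y in S, ~~ e x y].

(* A collection (F_1, ..., F_k) is a function on 'I_k, so repetitions are
   allowed and k = 0 is the empty collection. *)
Definition rainbow_set (k : nat) (F : 'I_k -> {set T}) (m : nat)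
    (S : {set T}) : Prop :=
  exists (i : 'I_m -> 'I_k) (x : 'I_m -> T),
    [/\ forall a b : 'I_m, a < b -> i a < i b,
        injective x,
        forall j, x j \in F (i j)
      & S = [set x j | j : 'I_m]].

Definition rainbow_forcing (n m k : nat) : Prop :=
  forall F : 'I_k -> {set T},
    (forall i, independent (F i) /\ #|F i| = n) ->
  exists S : {set T}, rainbow_set F m S /\ independent S.

Definition has_independent (n : nat) : Prop :=
  exists S : {set T}, independent S /\ #|S| = n.

(* [rainbow_number n m k] says f_G(n,m) = k, the least rainbow-forcing k.
   Fewer than m sets never have a rainbow m-set, so f_G(n,m) >= m as soon as G
   has an independent n-set.  If G has none, every k >= 1 is rainbow-forcing
   vacuously; the bound m <= k is then imposed, so that f_G(n,m) >= m holds for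
   every G.  In the presence of an independent n-set this is the plain minimum:
   see [rainbow_number_least]. *)
Definition rainbow_candidate (n m k : nat) : Prop :=
  rainbow_forcing n m k /\ (~ has_independent n -> m <= k).

Definition rainbow_number (n m k : nat) : Prop :=
  rainbow_candidate n m k /\
  forall k', rainbow_candidate n m k' -> k <= k'.

Lemma rainbow_number_least (n m k : nat) : has_independent n ->
  rainbow_number n m k <->
  (rainbow_forcing n m k /\ forall k', rainbow_forcing n m k' -> k <= k').
Proof.
move=> hn; split=> [[[fk _] mk]|[fk mk]].
  by split=> // k' fk'; apply: mk; split.
by split=> [|k' [fk' _]]; [split | apply: mk].
Qed.

End RainbowIndependentSets.

(* Main.v *)
Require Import Defs.
From mathcomp Require Import all_boot zify.

(** An independent set occupying half of a regular graph meets every edge, so it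
    is a colour class on each connected component, and there are only two
    choices per component.  Take a component [Y] of least size [2c].  If it is
    not the whole graph then [n - 1 >= 2c - 1], so [c] of the sets agree on [Y]
    and can be matched into their common trace on [Y]; delete [Y] and these [c]
    sets and induct.  On a single component, grow a set [P] inside one colour
    class one vertex at a time so that [P] always has at most [#|P| + 1]
    neighbours; the rest of the other class then has room for the sets of the
    other colour. *)

Lemma exists_subset_card {T : finType} (A : {set T}) (k : nat) :
  k <= #|A| -> exists2 B : {set T}, B \subset A & #|B| = k.
Proof.
elim: k => [|k IHk] hk; first by exists set0; rewrite ?sub0set ?cards0.
have [B sBA cB] := IHk (ltnW hk).
have /card_gt0P[x] : 0 < #|A :\: B| by move: (cardsD A B); rewrite (setIidPr sBA); lia.
rewrite inE => /andP[xB xA]; exists (x |: B); first by rewrite subUset sub1set xA.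
by rewrite cardsU1 xB cB.
Qed.

Section RegularGraph.

Context {T : finType} {e : rel T}.
Hypothesis e_sym : symmetric e.

Let N (x : T) := [set y | e x y].

(** * Double counting and colour classes in regular graphs *)

Lemma regular_double_count {d : nat} (A B : {set T}) : regular e d ->
    (forall x y, x \in A -> e x y -> y \in B) ->
  #|A| * d <= #|B| * d ?= iff [forall y in B, N y \subset A].
Proof.
move=> reg nAB.
(* Every edge leaving [A] ends in [B], so these edges can be counted by their ends in [B], at most
   [d] at each. *)
have -> : #|A| * d = \sum_(y in B) #|A :&: N y|.
  transitivity (\sum_(x in A) \sum_(y in B | e x y) 1).
    rewrite -sum_nat_const; apply: eq_bigr => x xA.
    rewrite sum1_card -(reg x); apply: eq_card => y; rewrite !inE unfold_in.
    by case exy: (e x y); rewrite ?andbF // (nAB _ _ xA exy).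
  rewrite (exchange_big_dep (mem B)) /=; last by move=> x y _ /andP[].
  apply: eq_bigr => y yB; rewrite sum1_card; apply: eq_card => x.
  by rewrite !inE unfold_in yB e_sym.
rewrite -sum_nat_const; apply: leqif_sum => y _.
rewrite -(reg y); have := subset_leqif_cards (subsetIr A (N y)).
by rewrite (sameP eqP setIidPr).
Qed.

(** A side of a proper 2-colouring of the whole graph: exactly one end of each edge, not merely at
    least one. *)
Definition meets_edges (S : {set T}) : Prop :=
  forall x y, e x y -> (x \in S) = (y \notin S).

Lemma independent_neighbor {S : {set T}} (x y : T) :
  independent e S -> x \in S -> e x y -> y \in ~: S.
Proof.
move=> /forall_inP indS xS exy; rewrite inE; apply: contraL exy => yS.
exact: (forall_inP (indS x xS)).
Qed.

Lemma independent_half_card {d : nat} {S : {set T}} :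
  0 < d -> regular e d -> independent e S -> #|S|.*2 <= #|T|.
Proof.
move=> d_gt0 reg indS.
have [+ _] := regular_double_count S (~: S) reg (fun x y => independent_neighbor x y indS).
by rewrite leq_pmul2r // -(cardsC S); lia.
Qed.

(** Equality holds in the double count from [S] to its complement, so a vertex outside [S] has all
    its neighbours in [S]. *)
Lemma independent_half_meets_edges {d : nat} {S : {set T}} :
  regular e d -> independent e S -> #|S|.*2 = #|T| -> meets_edges S.
Proof.
move=> reg indS cS.
have S_out x y := independent_neighbor x y indS.
have [_] := regular_double_count S (~: S) reg S_out.
have -> : #|~: S| = #|S| by move: (cardsC S); lia.
rewrite eqxx => /esym/forall_inP S_in x y exy; apply/idP/idP => [xS|yS].
  by have := S_out x y xS exy; rewrite inE.
by apply: (subsetP (S_in y _)); rewrite inE // e_sym.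
Qed.

Lemma meets_edges_compl {S : {set T}} : meets_edges S -> meets_edges (~: S).
Proof. by move=> hS x y exy; rewrite !inE negbK (hS x y exy) negbK. Qed.

(** Edges from either class of [X] lead to the other class inside [X], so double counting bounds
    each class by the other. *)
Lemma meets_edges_card {d : nat} {S X : {set T}} :
    0 < d -> regular e d -> meets_edges S -> closed e X ->
  #|X :&: S|.*2 = #|X|.
Proof.
move=> d_gt0 reg hS clX.
have le_part (S' : {set T}) : meets_edges S' -> #|X :&: S'| <= #|X :\: S'|.
  move=> hS'; rewrite -(leq_pmul2r d_gt0).
  apply: (regular_double_count _ _ reg) => x y; rewrite !inE => /andP[xX xS'] exy.
  by rewrite -(hS' x y exy) xS' -(clX x y exy).
have := le_part _ hS; have := le_part _ (meets_edges_compl hS).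
rewrite -setDE (setDE X (~: S)) setCK; have := cardsID S X; lia.
Qed.

(** Crossing an edge flips membership in both sets, so the vertices where they agree form a closed
    set. *)
Lemma meets_edges_agree {S S' : {set T}} {x y : T} :
    meets_edges S -> meets_edges S' -> connect e x y ->
  (x \in S) = (x \in S') -> (y \in S) = (y \in S').
Proof.
move=> hS hS' cxy agx.
have cl : closed e [set z | (z \in S) == (z \in S')].
  by move=> u v euv; rewrite !inE (hS _ _ euv) (hS' _ _ euv) (inj_eq negb_inj).
by have := closed_connect cl cxy; rewrite !inE agx eqxx => /esym/eqP.
Qed.

(* [P] is the trace on [S] of an arc of the cycle [Y]. *)
Lemma exists_arc {S Y : {set T}} {k : nat} :
    regular e 2 -> meets_edges S -> closed e Y -> {in Y &, forall x y, connect e x y} ->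
    k <= #|Y :&: S| ->
  exists P : {set T},
    [/\ P \subset Y :&: S, #|P| = k & #|\bigcup_(x in P) N x| <= k.+1].
Proof.
move=> reg hS clY conY.
(* Growing needs a vertex already in [P], so one vertex with its two neighbours is a separate base
   case. *)
elim: k => [|[|k] IHk] ltk; first by exists set0; rewrite sub0set cards0 big_set0 cards0.
  have /card_gt0P[x xYS] := ltk.
  by exists [set x]; rewrite sub1set xYS cards1 big_set1 reg.
have [P [sP cP cNP]] := IHk (ltnW ltk).
pose NP := \bigcup_(x in P) N x.
have memNP x y : x \in P -> e x y -> y \in NP.
  by move=> xP exy; apply/bigcupP; exists x; rewrite ?inE.
have NP_S y : y \in NP -> y \notin S.
  case/bigcupP=> x xP; rewrite inE => exy; rewrite -(hS _ _ exy).
  by have /subsetP/(_ x xP) := sP; rewrite inE => /andP[].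
have /card_gt0P[p pP] : 0 < #|P| by rewrite cP.
(* If a neighbour [y] of [P] has a neighbour [x] outside [P], adding [x] brings at most one new
   neighbour, since [y] is already counted. *)
have [/existsP[y /existsP[x /and3P[yNP xP eyx]]]|no_exit] :=
  boolP [exists y, exists x, [&& y \in NP, x \notin P & e y x]].
  exists (x |: P); split; last 1 first.
  - rewrite big_setU1 //= cardsU -/NP (reg x).
    have : 0 < #|N x :&: NP| by apply/card_gt0P; exists y; rewrite !inE e_sym eyx.
    by move: cNP; rewrite -/NP; lia.
  - rewrite subUset sP sub1set inE -(clY _ _ eyx) andbT.
    have := hS _ _ eyx; rewrite (negbTE (NP_S y yNP)) => /esym/negbFE ->.
    case/bigcupP: yNP => q qP; rewrite inE andbT => eqy; rewrite -(clY _ _ eqy).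
    by have /subsetP/(_ q qP) := sP; rewrite inE => /andP[].
  - by rewrite cardsU1 xP cP.
(* With no such exit, [P] and its neighbours cover [Y], so [P] would already contain [Y :&: S],
   against its size. *)
have cl : closed e (P :|: NP).
  apply: (intro_closed (sym_connect_sym e_sym)) => x y exy; rewrite !inE => /orP[xP|xNP].
    by rewrite (memNP x y) ?orbT.
  case yP: (y \in P) => //=; case/negP: no_exit.
  by apply/existsP; exists x; apply/existsP; exists y; rewrite xNP yP.
suff /subset_leq_card : Y :&: S \subset P by rewrite cP leqNgt ltk.
apply/subsetP=> x; rewrite inE => /andP[xY xS].
have /subsetP/(_ p pP) := sP; rewrite inE => /andP[pY _].
have := closed_connect cl (conY p x pY xY); rewrite !inE pP /= => /esym/orP[//|/NP_S].
by rewrite xS.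
Qed.

(** * Rainbow choices and how to combine them *)

(** Indexing by a set [J] and confining values to [X] lets indices and vertices be split together;
    [f] is total, but only its values on [J] matter. *)
Definition rainbow_choice {I : finType} (F : I -> {set T}) (J : {set I})
    (X : {set T}) : Prop :=
  exists f : I -> T,
    [/\ {in J &, injective f}, {in J, forall i, f i \in F i},
        {in J, forall i, f i \in X} & {in J &, forall i j, ~~ e (f i) (f j)}].

Lemma rainbow_choice_const {I : finType} {F : I -> {set T}} {J : {set I}}
    {P : {set T}} : T -> independent e P ->
  {in J, forall i, P \subset F i} -> #|J| <= #|P| -> rainbow_choice F J P.
Proof.
move=> x0 indP sPF leJP.
(* Enumerations of [J] and [P] are matched by position; the default [x0] is never reached on [J]. *)
pose f i := nth x0 (enum P) (index i (enum J)).
have ltJ i : i \in J -> index i (enum J) < #|P|.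
  by move=> iJ; rewrite (leq_trans _ leJP) // cardE index_mem mem_enum.
have fP i : i \in J -> f i \in P.
  by move=> iJ; rewrite -mem_enum mem_nth // -cardE ltJ.
exists f; split=> [i j iJ jJ /eqP|i iJ|i iJ|i j iJ jJ].
- rewrite nth_uniq ?enum_uniq -?cardE ?ltJ // => /eqP eij.
  by apply: (index_inj i) eij; rewrite mem_enum.
- exact: subsetP (sPF i iJ) _ (fP i iJ).
- exact: fP.
- by have /forall_inP/(_ _ (fP i iJ))/forall_inP/(_ _ (fP j jJ)) := indP.
Qed.

Lemma rainbow_choiceU {I : finType} (F : I -> {set T}) (J J1 : {set I})
    (X X1 X2 : {set T}) :
    X1 \subset X -> X2 \subset X -> [disjoint X1 & X2] ->
    (forall x y, x \in X1 -> y \in X2 -> ~~ e x y) ->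
    rainbow_choice F (J :&: J1) X1 -> rainbow_choice F (J :\: J1) X2 ->
  rainbow_choice F J X.
Proof.
move=> s1 s2 dX no12 [f1 [inj1 F1 r1 e1]] [f2 [inj2 F2 r2 e2]].
exists (fun i => if i \in J1 then f1 i else f2 i).
have m1 i : i \in J -> i \in J1 -> i \in J :&: J1 by rewrite inE => -> ->.
have m2 i : i \in J -> i \in J1 = false -> i \in J :\: J1 by rewrite inE => -> ->.
have ne i j : i \in J :&: J1 -> j \in J :\: J1 -> f1 i <> f2 j.
  by move=> iJ jJ eij; have := disjointFr dX (r1 i iJ); rewrite eij r2.
split=> [i j|i|i|i j] iJ.
- move=> jJ; case: ifP => i1; case: ifP => j1.
  + by apply: inj1; apply: m1.
  + by move/(ne _ _ (m1 _ iJ i1) (m2 _ jJ j1)).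
  + by move/esym/(ne _ _ (m1 _ jJ j1) (m2 _ iJ i1)).
  + by apply: inj2; apply: m2.
- by case: ifP => i1; [apply/F1/m1 | apply/F2/m2].
- by case: ifP => i1; [apply/(subsetP s1)/r1/m1 | apply/(subsetP s2)/r2/m2].
- move=> jJ; case: ifP => i1; case: ifP => j1.
  + by apply: e1; apply: m1.
  + by apply: no12; [apply/r1/m1 | apply/r2/m2].
  + by rewrite e_sym; apply: no12; [apply/r1/m1 | apply/r2/m2].
  + by apply: e2; apply: m2.
Qed.

Lemma meets_edges_independent {S P : {set T}} :
  meets_edges S -> P \subset S -> independent e P.
Proof.
move=> hS sP; apply/forall_inP => x xP; apply/forall_inP => y yP.
by apply/negP => /hS; rewrite !(subsetP sP).
Qed.

(** * A single component *)

Lemma rainbow_choice_connected {I : finType} (F : I -> {set T}) (J : {set I})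
    (X : {set T}) : regular e 2 -> (forall i, meets_edges (F i)) ->
    closed e X -> {in X &, forall x y, connect e x y} ->
  (#|J|.+1).*2 = #|X| -> rainbow_choice F J X.
Proof.
move=> reg hF clX conX cJ.
have X_gt0 : 0 < #|X| by rewrite -cJ.
have /card_gt0P[x xX] := X_gt0.
have [->|/set0Pn[i0 i0J]] := eqVneq J set0.
  by exists (fun=> x); split=> i; rewrite inE.
pose S := F i0; have hS : meets_edges S := hF i0.
have cS := meets_edges_card (isT : 0 < 2) reg hS clX.
(* On the connected [X] each [F i] traces either [S] or its complement, and the vertex [x] decides
   which. *)
pose J1 := [set i | (x \in F i) == (x \in S)].
have [|P [sP cP cNP]] := @exists_arc S X #|J :&: J1| reg hS clX conX.
  by have := subset_leq_card (subsetIl J J1); lia.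
pose NP := \bigcup_(z in P) N z.
pose Q := (X :\: S) :\: NP.
(* [X :\: S] has [#|J| + 1] vertices and [P] has at most [#|J :&: J1| + 1] neighbours: the two extra
   ones cancel. *)
have cQ : #|J :\: J1| <= #|Q|.
  have := cardsID NP (X :\: S); have := cardsID S X; have := cardsID J1 J.
  have := subset_leq_card (subsetIr (X :\: S) NP).
  by move: cNP; rewrite -/NP /Q; lia.
have hCS := meets_edges_compl hS.
have sQ : Q \subset ~: S by apply/subsetP => z; rewrite !inE => /and3P[].
have [sPX sPS] : P \subset X /\ P \subset S by apply/andP; rewrite -subsetI.
have sQX : Q \subset X by apply/subsetP => z; rewrite !inE => /and3P[].
have agree i (S' : {set T}) z : meets_edges S' -> (x \in F i) = (x \in S') ->
    z \in X -> (z \in F i) = (z \in S').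
  by move=> hS' agx zX; apply: meets_edges_agree (hF i) hS' (conX x z xX zX) agx.
apply: (@rainbow_choiceU _ _ _ J1 _ P Q) => //.
- rewrite disjoint_sym disjoints_subset; apply: (subset_trans sQ).
  by rewrite setCS.
- move=> u v uP; rewrite !inE => /and3P[vNP _ _]; apply: contra vNP => euv.
  by apply/bigcupP; exists u; rewrite ?inE.
- apply: (rainbow_choice_const x (meets_edges_independent hS sPS)) => //; last by rewrite cP.
  move=> i; rewrite !inE => /andP[_ /eqP agi]; apply/subsetP => z zP.
  by rewrite (agree i S z hS agi (subsetP sPX z zP)) (subsetP sPS z zP).
- apply: (rainbow_choice_const x (meets_edges_independent hCS sQ)) => //.
  move=> i; rewrite !inE => /andP[agi _]; apply/subsetP => z zQ.
  rewrite (agree i (~: S) z hCS _ (subsetP sQX z zQ)) ?(subsetP sQ z zQ) // inE.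
  by case: (x \in F i) (x \in S) agi => [] [].
Qed.

(** * Induction over components *)

Lemma rainbow_choice_closed {I : finType} (F : I -> {set T}) (J : {set I})
    (X : {set T}) : regular e 2 -> (forall i, meets_edges (F i)) ->
    closed e X -> (#|J|.+1).*2 = #|X| ->
  rainbow_choice F J X.
Proof.
move=> reg hF; have [m] := ubnP #|X|.
elim: m J X => // m IHm J X ltXm clX cJ.
have csym := sym_connect_sym e_sym.
pose C x := [set y | connect e x y].
have clC x : closed e (C x).
  apply: (intro_closed csym) => u v euv; rewrite !inE => cxu.
  exact: connect_trans cxu (connect1 euv).
have /card_gt0P[x0 x0X] : 0 < #|X| by rewrite -cJ.
have [x xX minx] := arg_minnP (fun x => #|C x|) x0X.
set Y := C x in minx *.
have xY : x \in Y by rewrite inE connect0.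
have sYX : Y \subset X.
  by apply/subsetP=> y; rewrite inE => /(closed_connect clX) <-.
have [eYX|neYX] := eqVneq Y X.
  apply: rainbow_choice_connected => // u v.
  by rewrite -eYX !inE => + cxv; rewrite csym => /connect_trans; apply.
have clZ : closed e (X :\: Y).
  by move=> u v euv; rewrite !in_setD (clX u v euv) (clC x u v euv).
have /set0Pn[z zZ] : X :\: Y != set0.
  by rewrite setD_eq0; apply: contra neYX => sXY; rewrite eqEsubset sYX.
(* The rest of [X] contains a whole component, which is no smaller than [Y]. *)
have leYZ : #|Y| <= #|X :\: Y|.
  have zX : z \in X by move: zZ; rewrite inE => /andP[].
  apply: leq_trans (minx z zX) (subset_leq_card _).
  by apply/subsetP=> y; rewrite inE => /(closed_connect clZ) <-.
have cXY : #|X| = #|Y| + #|X :\: Y| by rewrite -(cardsID Y X) (setIidPr sYX).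
have leY : 2 <= #|Y|.
  rewrite -(reg x); apply/subset_leq_card/subsetP => y; rewrite !inE.
  exact: connect1.
have /card_gt0P[i0 _] : 0 < #|J| by lia.
(* Pigeonhole: [leYZ] gives [#|J| >= #|Y| - 1], and [#|Y|] is even, so one of the two colour classes
   of [Y] is the trace of at least [#|Y| / 2] sets. *)
have [S hS leS] : exists2 S, meets_edges S &
    #|Y| <= #|J :&: [set i | (x \in F i) == (x \in S)]|.*2.
  have := cardsID [set i | (x \in F i) == (x \in F i0)] J.
  set A := [set i | _]; have [leA _|ltA cA] := leqP #|Y| #|J :&: A|.*2.
    by exists (F i0).
  exists (~: F i0); first exact: meets_edges_compl.
  have -> : [set i | (x \in F i) == (x \in ~: F i0)] = ~: A.
    by apply/setP => i; rewrite !inE; case: (x \in F i) (x \in F i0) => [] [].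
  have := meets_edges_card (isT : 0 < 2) reg (hF i0) (clC x).
  by rewrite -setDE -/Y; lia.
have cYS : #|Y :&: S|.*2 = #|Y| := meets_edges_card (isT : 0 < 2) reg hS (clC x).
have [|J1] := @exists_subset_card _ (J :&: [set i | (x \in F i) == (x \in S)]) #|Y :&: S|.
  by lia.
rewrite subsetI => /andP[sJ1 /subsetP agJ1] cJ1.
have sYS : Y :&: S \subset X by apply: subset_trans (subsetIl _ _) sYX.
apply: (@rainbow_choiceU _ _ _ J1 _ (Y :&: S) (X :\: Y)); rewrite ?subsetDl //.
- by rewrite disjoint_sym disjoints_subset; apply/subsetP => u; rewrite !inE => /andP[/negbTE ->].
- move=> u v; rewrite !in_setD in_setI => /andP[uY _] /andP[vY _].
  by apply: contra vY => euv; rewrite -(clC x u v euv).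
- rewrite (setIidPr sJ1); apply: (rainbow_choice_const x) => //; last by rewrite cJ1.
    exact: meets_edges_independent hS (subsetIr _ _).
  move=> i /agJ1; rewrite inE => /eqP agi; apply/subsetP => y; rewrite !inE => /andP[cxy yS].
  by rewrite (meets_edges_agree (hF i) hS cxy agi).
(* Removing [#|Y|] vertices and half as many indices preserves the relation between [#|J|] and
   [#|X|]. *)
- apply: IHm => //; first by lia.
  by have := cardsID J1 J; rewrite (setIidPr sJ1); lia.
Qed.

End RegularGraph.

(** * The value of the rainbow number *)

Theorem theorem1p5 (n : nat) (T : finType) (e : rel T) :
  0 < n ->
  symmetric e -> irreflexive e -> regular e 2 ->
  2 * n - 1 <= #|T| <= 2 * n ->
  rainbow_number e n (n - 1) (n - 1).
Proof.
move=> n_gt0 e_sym _ reg /andP[_ leTn].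
suff forcing : rainbow_forcing e n (n - 1) (n - 1).
  split=> [|k' [fk' hk']]; first by split.
  rewrite leqNgt; apply/negP => ltk.
  suff noS : ~ has_independent e n by move: (hk' noS); lia.
  (* Repeating [S] [k'] times, a rainbow set would inject [n - 1] positions into [k'] indices. *)
  case=> S hS; have [_ [[i [_ [imono _ _ _]]] _]] := fk' (fun=> S) (fun=> hS).
  have /leq_card : injective i; last by rewrite !card_ord leqNgt ltk.
  move=> a b eab; apply/val_inj.
  by case: (ltngtP a b) => // /imono; rewrite eab ltnn.
(* For [n = 1] the collection is empty and the empty set is the rainbow set. *)
case: (posnP (n - 1)) => [->|n1_gt0] F hF.
  exists set0; split; last by apply/forall_inP=> x; rewrite inE.
  exists id, (fun j : 'I_0 => False_rect T (notF (ltn_ord j))).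
  by split=> [//|[]|[]|] //; apply/setP=> x; rewrite inE; apply/esym/imsetP => -[[]].
(* An independent set fills at most half of the graph, so the [n] vertices of [F i] force
   [#|T| = 2n]. *)
have F_edges i : meets_edges (e := e) (F i).
  have [indF cF] := hF i; apply: (independent_half_meets_edges e_sym reg indF).
  by have := independent_half_card e_sym (isT : 0 < 2) reg indF; lia.
have cT : #|T| = n.*2.
  have [indF cF] := hF (Ordinal n1_gt0).
  by have := independent_half_card e_sym (isT : 0 < 2) reg indF; lia.
have [||f [injf Ff _ ef]] := @rainbow_choice_closed _ _ e_sym _ F setT setT reg F_edges.
- by move=> u v _; rewrite !inE.
- by rewrite !cardsT card_ord cT; lia.
exists [set f j | j : 'I_(n - 1)]; split.
  exists id, f; split=> // [i j|i]; [by apply: injf | exact: Ff].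
apply/forall_inP=> _ /imsetP[i _ ->]; apply/forall_inP=> _ /imsetP[j _ ->].
by apply: ef.
Qed.
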